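(* Let $\varepsilon>0$ and let $\ell>0$ be an integer. Then, for a density one sub-sequence of $n\in S$, one has $\mathcal{V}^t(n,\ell,n^{1/2-\varepsilon})=\emptyset$ for $t=1,2$; that is, for $t\in\{1,2\}$ there are no $\ell$-tuples $(\xi^1,\dots,\xi^\ell)$ of lattice points $\xi^j=(\xi^j_1,\xi^j_2)\in\mathbb{Z}^2$ with $|\xi^j|^2=n$ such that $$0<|\xi_t^1+\dots+\xi_t^\ell|\le n^{1/2-\varepsilon}.$$
   Context: $S$ is the set of positive integers $n$ of the form $n=a^2+b^2$ with $a,b\in\mathbb{Z}$. A sub-sequence $S_0\subset S$ has density one if $\lim_{X\to\infty}|\{n\in S_0:n\le X\}|/|\{n\in S:n\le X\}|=1$. For $K>0$ and $t\in\{1,2\}$, $\mathcal{V}^t(n,\ell,K)$ is the set of $\ell$-tuples $(\xi^1,\dots,\xi^\ell)$ of points $\xi^j=(\xi_1^j,\xi_2^j)\in\mathbb{Z}^2$ with $|\xi^j|^2=n$ satisfying $0<|\xi_t^1+\dots+\xi_t^\ell|\le K$. *)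

(* Defs.v *)
From HB Require Import structures.
From mathcomp Require Import all_boot all_order all_algebra.
From mathcomp Require Import finmap.
From mathcomp Require Import all_classical all_reals all_analysis.
Set Implicit Arguments.
Unset Strict Implicit.
Unset Printing Implicit Defensive.
Import Order.TTheory GRing.Theory Num.Theory.
Import numFieldNormedType.Exports.
Local Open Scope classical_set_scope.
Local Open Scope ring_scope.

Definition two_squares : set nat :=
  [set n | (0 < n)%N /\ exists a b : int, n%:Z = a ^+ 2 + b ^+ 2].

(* [fset_set] is the empty set on infinite sets; the set below is always
   finite, so this is its true cardinality. *)
Definition count_le (R : realType) (A : set nat) (X : R) : nat :=
  #|` fset_set [set n | A n /\ n%:R <= X] |%fset.

Definition density_one (R : realType) (S0 : set nat) : Prop :=
  S0 `<=` two_squares /\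
  (count_le S0 X)%:R / (count_le two_squares X)%:R @[X --> (+oo : set_system R)]
    --> (1 : R).

(* Points of Z^2 are row vectors; the coordinates numbered 1 and 2 in the
   usual notation are those of index 0 and 1 in 'I_2. *)
Definition sqnorm (xi : 'rV[int]_2) : int := xi 0 0 ^+ 2 + xi 0 1 ^+ 2.

Definition Vset (R : realType) (t : 'I_2) (n l : nat) (K : R) :
    set (l.-tuple 'rV[int]_2) :=
  [set xi | (forall j : 'I_l, sqnorm (tnth xi j) = n%:Z) /\
            0 < `|\sum_(j < l) tnth xi j 0 t| /\
            (`|\sum_(j < l) tnth xi j 0 t|)%:~R <= K].
Arguments Vset {R} t n l K.

(* Main.v *)
(* Factoring l Gaussian integers of equal norm n against one another
   yields k = 2^(l-1) Gaussian integers w_i with prod |w_i|^2 = n such that every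
   point is a unit times the product of the w_i, some of them conjugated. A
   coordinate of the sum of the points is then one of finitely many maps
   T : Z[i]^k -> Z that are additive in each variable, and n is exceptional only
   if 0 < |T(w)| <= n^(-eps) prod |w_i| for such a T. By induction on the number
   of variables, in every box |w_i| <= H_i this holds for a proportion of w that
   is smaller than 1 by a power of n: either the coefficients of T in the first
   variable are small themselves, or that variable lies in a thin strip. Hence
   there are O(X^(1-delta)) exceptional n <= X. On the other hand the same
   factorisation, for two points, and Cauchy-Schwarz give at least
   X^(1-delta/2) sums of two squares up to X, so no asymptotic formula for their
   number is needed. *)

Require Import Defs.
From HB Require Import structures.
From mathcomp Require Import all_boot all_order all_algebra.
From mathcomp Require Import finmap.
From mathcomp Require Import all_classical all_reals all_analysis.
From mathcomp Require Import zify ring.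
Set Implicit Arguments.
Unset Strict Implicit.
Unset Printing Implicit Defensive.
Import Order.TTheory GRing.Theory Num.Theory.
Import numFieldNormedType.Exports.
Local Open Scope classical_set_scope.
Local Open Scope ring_scope.

(** * Gaussian integers *)

Record gint := Gint { gre : int; gim : int }.

Definition gint_pair (z : gint) := (gre z, gim z).
Definition pair_gint (p : int * int) := Gint p.1 p.2.
Lemma gint_pairK : cancel gint_pair pair_gint.
Proof. by case. Qed.
HB.instance Definition _ := Choice.copy gint (can_type gint_pairK).

Lemma gintP (z w : gint) : gre z = gre w -> gim z = gim w -> z = w.
Proof. by case: z w => [a b] [c d] /= -> ->. Qed.

Definition gadd z w := Gint (gre z + gre w) (gim z + gim w).
Definition gopp z := Gint (- gre z) (- gim z).
Definition gmul z w :=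
  Gint (gre z * gre w - gim z * gim w) (gre z * gim w + gim z * gre w).
Definition gconj z := Gint (gre z) (- gim z).

Lemma gaddA : associative gadd.
Proof. by move=> x y z; apply: gintP => /=; ring. Qed.
Lemma gaddC : commutative gadd.
Proof. by move=> x y; apply: gintP => /=; ring. Qed.
Lemma gadd0 : left_id (Gint 0 0) gadd.
Proof. by move=> x; apply: gintP => /=; ring. Qed.
Lemma gaddN : left_inverse (Gint 0 0) gopp gadd.
Proof. by move=> x; apply: gintP => /=; ring. Qed.
HB.instance Definition _ := GRing.isZmodule.Build gint gaddA gaddC gadd0 gaddN.

Lemma gmulA : associative gmul.
Proof. by move=> x y z; apply: gintP => /=; ring. Qed.
Lemma gmulC : commutative gmul.
Proof. by move=> x y; apply: gintP => /=; ring. Qed.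
Lemma gmul1 : left_id (Gint 1 0) gmul.
Proof. by move=> x; apply: gintP => /=; ring. Qed.
Lemma gmulD : left_distributive gmul +%R.
Proof. by move=> x y z; apply: gintP => /=; ring. Qed.
Lemma gone_neq0 : Gint 1 0 != 0.
Proof. by []. Qed.
HB.instance Definition _ :=
  GRing.Zmodule_isComNzRing.Build gint gmulA gmulC gmul1 gmulD gone_neq0.

Lemma gmulE z w : z * w =
  Gint (gre z * gre w - gim z * gim w) (gre z * gim w + gim z * gre w).
Proof. by []. Qed.

Lemma gconjM z w : gconj (z * w) = gconj z * gconj w.
Proof. by rewrite !gmulE; apply: gintP => /=; ring. Qed.

Lemma gconjK : involutive gconj.
Proof. by move=> z; apply: gintP => //=; ring. Qed.

Definition gnorm (z : gint) : nat := `|gre z|%N ^ 2 + `|gim z|%N ^ 2.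
Arguments gnorm z%_R.

Lemma gnormE z : (gnorm z)%:Z = gre z ^+ 2 + gim z ^+ 2.
Proof. rewrite /gnorm PoszD !PoszM; lia. Qed.

Lemma gnormM z w : gnorm (z * w) = (gnorm z * gnorm w)%N.
Proof. by apply/eqP; rewrite -eqz_nat PoszM !gnormE gmulE /=; apply/eqP; ring. Qed.

Lemma gnorm_conj z : gnorm (gconj z) = gnorm z.
Proof. by rewrite /gnorm /= abszN. Qed.

Lemma gnorm_gt0 z : (0 < gnorm z)%N = (z != 0).
Proof.
apply/idP/idP => [|]; first by apply: contraTneq => ->.
case: z => a b h; rewrite /gnorm /= addn_gt0 !expn_gt0 !orbF !absz_gt0.
by apply: contraNT h; rewrite negb_or !negbK => /andP[/eqP -> /eqP ->].
Qed.

Lemma mul_gconj z : z * gconj z = Gint (gnorm z) 0.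
Proof. by rewrite gmulE; apply: gintP; rewrite /= ?gnormE; ring. Qed.

Lemma gmulI (z : gint) : z != 0 -> injective ( *%R z).
Proof.
rewrite -gnorm_gt0 => z0 x y e; apply/eqP; rewrite -subr_eq0.
have : gnorm (z * (x - y)) = 0%N by rewrite mulrBr e subrr.
rewrite gnormM => /eqP; rewrite muln_eq0 eqn0Ngt z0 /= => h.
by apply/negPn; rewrite -gnorm_gt0 (eqP h).
Qed.

(** * Euclidean division and coprimality *)

Lemma int_round (a : int) (n : nat) : (0 < n)%N ->
  exists q : int, (2 * (a - q * n%:Z)) ^+ 2 <= n%:Z ^+ 2.
Proof.
(* The floor of [a / n + 1/2], that is, an integer nearest to [a / n]. *)
move=> n0; exists ((2 * a + n%:Z) %/ (2 * n%:Z))%Z.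
have n2 : 2 * n%:Z != 0 by lia.
have := modz_ge0 (2 * a + n%:Z) n2; have := ltz_mod (2 * a + n%:Z) n2.
rewrite /modz; set q := (_ %/ _)%Z => *; nia.
Qed.

Lemma gint_div (a b : gint) : b != 0 -> exists q, (gnorm (a - q * b) < gnorm b)%N.
Proof.
move=> b0; have nb := b0; rewrite -gnorm_gt0 in nb.
have [q1 h1] := int_round (gre (a * gconj b)) nb.
have [q2 h2] := int_round (gim (a * gconj b)) nb.
exists (Gint q1 q2).
(* Scaling by the norm of [b] replaces [a - q * b] by its product with [gconj b]. The coordinates of
   that product are the two rounding errors, each at most half of [gnorm b], so its norm is at most
   half of [gnorm b ^ 2]. *)
suff : (gnorm (a - Gint q1 q2 * b) * gnorm b < gnorm b * gnorm b)%N by rewrite ltn_pmul2r.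
rewrite -[X in (_ * X < _)%N]gnorm_conj -gnormM mulrBl -mulrA mul_gconj -ltz_nat.
rewrite gnormE PoszM.
have -> : gre (a * gconj b - Gint q1 q2 * Gint (gnorm b) 0) =
  gre (a * gconj b) - q1 * (gnorm b)%:Z by rewrite /=; ring.
have -> : gim (a * gconj b - Gint q1 q2 * Gint (gnorm b) 0) =
  gim (a * gconj b) - q2 * (gnorm b)%:Z by rewrite /=; ring.
move: (gre _) (gim _) (gnorm b) nb h1 h2 => u v n nb h1 h2; nia.
Qed.

Lemma gint_bezout (a b : gint) : exists g u v x y : gint,
  [/\ g = u * a + v * b, a = x * g & b = y * g].
Proof.
have [n] := ubnP (gnorm b); elim: n a b => // n IH a b; rewrite ltnS => le_n.
have [->|b0] := eqVneq b 0.
  by exists a, 1, 0, 1, 0; split; ring.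
have [q hq] := gint_div a b0.
have [g [u [v [x [y [hg hb hr]]]]]] := IH b (a - q * b) (leq_trans hq le_n).
exists g, v, (u - v * q), (y + q * x), x; split => //; first by rewrite hg; ring.
by rewrite mulrDl -hr -mulrA -hb subrK.
Qed.

Lemma gint_gcd (a b : gint) : a != 0 -> exists g u v x y : gint,
  [/\ g != 0, u * x + v * y = 1, a = x * g & b = y * g].
Proof.
move=> a0; have [g [u [v [x [y [hg ha hb]]]]]] := gint_bezout a b.
have g0 : g != 0 by apply: contraNneq a0 => e; rewrite ha e mulr0.
exists g, u, v, x, y; split => //; apply: (gmulI g0).
by rewrite mulr1 [RHS]hg ha hb; ring.
Qed.

(** Removing a gcd [g] leaves coprime [b] and [b'] with [b * gconj b = b' * gconj b']. Hence [b]
    divides [gconj b'], and the quotient has norm 1. *)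
Lemma same_norm (z z' : gint) : z != 0 -> gnorm z = gnorm z' ->
  exists g b u, [/\ gnorm u = 1%N, z = g * b & z' = u * (g * gconj b)].
Proof.
move=> z0 e; have [g [u [v [b [b' [g0 huv hz hz']]]]]] := gint_gcd z' z0.
have b0 : b != 0 by apply: contraNneq z0 => eb; rewrite hz eb mul0r.
have nbb : gnorm b = gnorm b'.
  move: e; rewrite hz hz' !gnormM => /eqP.
  by rewrite eqn_pmul2r ?gnorm_gt0 // => /eqP.
have e2 : b * gconj b = b' * gconj b' by rewrite !mul_gconj nbb.
pose c := u * gconj b' + v * gconj b.
have hc : gconj b' = c * b.
  transitivity ((u * b + v * b') * gconj b'); first by rewrite huv mul1r.
  rewrite mulrDl -[v * b' * _]mulrA -e2 /c; ring.
exists g, b, (gconj c); split; last 2 first.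
- by rewrite hz mulrC.
- by rewrite hz' -[b']gconjK hc gconjM; ring.
move: nbb; rewrite gnorm_conj -[RHS]gnorm_conj hc gnormM => /esym/eqP.
by rewrite -[X in _ == X]mul1n eqn_pmul2r ?gnorm_gt0 // => /eqP.
Qed.

(** Take for [g1] a gcd of [g] and [w]: the cofactor of [g] is coprime to that of [w], hence divides
    [W]. *)
Lemma gint_riesz (w W g h : gint) : g != 0 -> w * W = g * h ->
  exists g1 h1 g2 h2, [/\ w = g1 * h1, W = g2 * h2, g = g1 * g2 & h = h1 * h2].
Proof.
move=> g0 e; have [d [u [v [x [y [d0 huv hg hw]]]]]] := gint_gcd w g0.
have x0 : x != 0 by apply: contraNneq g0 => ex; rewrite hg ex mul0r.
have e2 : y * W = x * h.
  by apply: (gmulI d0); rewrite mulrA [d * y]mulrC -hw e hg; ring.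
have hW : W = x * (u * W + v * h).
  rewrite mulrDr !mulrA [x * v]mulrC -[v * x * h]mulrA -e2 mulrA -mulrDl.
  by rewrite [x * u]mulrC huv mul1r.
exists d, y, x, (u * W + v * h); split=> //; try by rewrite mulrC.
by apply: (gmulI x0); rewrite -e2 {1}hW; ring.
Qed.

(** * Common factorisation of the points of a circle *)

Definition gtwist (b : bool) (z : gint) := if b then gconj z else z.

Lemma gtwistM b z w : gtwist b (z * w) = gtwist b z * gtwist b w.
Proof. by case: b; rewrite //= gconjM. Qed.

Lemma gnorm_twist b z : gnorm (gtwist b z) = gnorm z.
Proof. by case: b; rewrite //= gnorm_conj. Qed.

(** A point of the circle up to a unit: the factors [w] are shared by all points, and only the
    conjugation pattern [s] depends on the point. *)
Fixpoint gtprod (s : seq bool) (w : seq gint) : gint :=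
  if s is b :: s' then if w is z :: w' then gtwist b z * gtprod s' w' else 1 else 1.

Lemma gtprod_cat s1 s2 w1 w2 : size s1 = size w1 ->
  gtprod (s1 ++ s2) (w1 ++ w2) = gtprod s1 w1 * gtprod s2 w2.
Proof.
elim: s1 w1 => [|b s1 IH] [|z w1] //= => [_|[e]]; first by rewrite mul1r.
by rewrite IH // mulrA.
Qed.

Lemma gtprod_nseq b w : gtprod (nseq (size w) b) w = gtwist b (\prod_(z <- w) z).
Proof.
elim: w => [|z w IH]; first by rewrite big_nil; case: b => //=; apply: gintP.
by rewrite big_cons gtwistM /= IH.
Qed.

(** Applying [gint_riesz] factor by factor refines [w]. Twisting is multiplicative, so every point
    already expressed through [w] remains expressed through the refinement; this is the last
    clause. *)
Lemma gprod_split (w : seq gint) (g h : gint) : g != 0 -> w != [::] ->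
  \prod_(z <- w) z = g * h ->
  exists gs hs, [/\ size gs = size w, size hs = size w,
    \prod_(z <- gs) z = g, \prod_(z <- hs) z = h &
    forall s, gtprod s w = gtprod s gs * gtprod s hs].
Proof.
elim: w g h => // z w IH g h g0 _; have [->|w0] := eqVneq w [::].
  rewrite big_seq1 => ->; exists [:: g], [:: h]; rewrite !big_seq1; split => //.
  by move=> [|b [|c s]] //=; rewrite ?mulr1 ?gtwistM.
rewrite big_cons => /(gint_riesz g0) [g1 [h1 [g2 [h2 [hz hw hg hh]]]]].
have g20 : g2 != 0 by apply: contraNneq g0 => e; rewrite hg e mulr0.
have [gs [hs [s1 s2 p1 p2 hs3]]] := IH g2 h2 g20 w0 hw.
exists (g1 :: gs), (h1 :: hs); rewrite /= s1 s2 !big_cons p1 p2; split => //.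
move=> [|b s] /=; first by rewrite mulr1.
by rewrite hs3 hz gtwistM; ring.
Qed.

(* Each further point of the circle splits every factor in two: the part it
   shares with the first point, and the part it conjugates. *)
Lemma circle_param (m n : nat) (z : nat -> gint) : (0 < n)%N ->
  (forall j, (j <= m)%N -> gnorm (z j) = n) ->
  exists (w : seq gint) (s : nat -> seq bool) (u : nat -> gint),
  [/\ size w = (2 ^ m)%N, \prod_(x <- w) x = z 0%N &
    forall j, (j <= m)%N ->
      [/\ size (s j) = (2 ^ m)%N, gnorm (u j) = 1%N & z j = u j * gtprod (s j) w]].
Proof.
move=> n0; elim: m => [|m IH] hz.
  exists [:: z 0%N], (fun=> [:: false]), (fun=> 1); rewrite big_seq1; split => //.
  by case=> // _; split => //=; rewrite mulr1 mul1r.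
have [j /leqW /hz //|w [s [u [sw pw hw]]]] := IH.
have z0 : z 0%N != 0 by rewrite -gnorm_gt0 hz.
have [g [b [v [nv h0 h1]]]] :=
  same_norm z0 (etrans (hz 0%N isT) (esym (hz m.+1 (leqnn _)))).
have g0 : g != 0 by apply: contraNneq z0 => e; rewrite h0 e mul0r.
have w0 : w != [::] by rewrite -size_eq0 sw -lt0n expn_gt0.
have [gs [hs [s1 s2 p1 p2 e]]] := gprod_split g0 w0 (etrans pw h0).
(* The first point is [g * b] and the new one is a unit times [g * gconj b]: the factors of [g] stay
   plain and those of [b] are conjugated. Earlier points repeat their pattern on both halves. *)
exists (gs ++ hs), (fun j => if j == m.+1 then nseq (2 ^ m) false ++ nseq (2 ^ m) true
  else s j ++ s j), (fun j => if j == m.+1 then v else u j).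
rewrite size_cat s1 s2 sw addnn -mul2n -expnS big_cat /= p1 p2 -h0; split => //.
move=> j; rewrite leq_eqVlt; have [-> _|/= _] := eqVneq.
  split=> //; first by rewrite size_cat !size_nseq addnn -mul2n -expnS.
  rewrite gtprod_cat ?size_nseq ?s1 ?sw //.
  by rewrite -{1}sw -s1 -{1}sw -s2 !gtprod_nseq p1 p2.
rewrite ltnS => /hw [ss nu ->]; split=> //.
  by rewrite size_cat ss addnn -mul2n -expnS.
by rewrite gtprod_cat ?ss ?s1 ?sw // -e.
Qed.

Lemma gnorm_gtprod s w : size s = size w ->
  gnorm (gtprod s w) = (\prod_(z <- w) gnorm z)%N.
Proof.
elim: s w => [|b s IH] [|z w] //=; first by rewrite big_nil.
by case=> e; rewrite big_cons gnormM gnorm_twist IH.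
Qed.

(** * Small values of multilinear forms *)

Lemma count_allpairs (S T U : Type) (P : pred U) (f : S -> T -> U) s t :
  count P [seq f x y | x <- s, y <- t] =
  (\sum_(x <- s) count (fun y => P (f x y)) t)%N.
Proof.
elim: s => [|x s IH]; first by rewrite big_nil.
by rewrite big_cons -IH /= count_cat count_map.
Qed.

Lemma exchange_count (S T : Type) (P : S -> T -> bool) s t :
  (\sum_(x <- s) count (P x) t = \sum_(y <- t) count (P^~ y) s)%N.
Proof.
under eq_bigr do rewrite -sum1_count big_mkcond.
rewrite exchange_big; apply: eq_bigr => y _.
by rewrite -sum1_count [RHS]big_mkcond.
Qed.

Definition irange (h : nat) : seq int := [seq i%:Z - h%:Z | i <- iota 0 h.*2.+1].
Arguments irange : simpl never.

Definition gsquare (h : nat) : seq gint :=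
  [seq Gint x y | x <- irange h, y <- irange h].
Arguments gsquare : simpl never.

Fixpoint gbox (H : seq nat) : seq (seq gint) :=
  if H is h :: H' then [seq z :: w | z <- gsquare h, w <- gbox H'] else [:: [::]].

Lemma mem_irange h (x : int) : (x \in irange h) = (`|x| <= h)%N.
Proof.
apply/mapP/idP => [[i]|hx]; first by rewrite mem_iota; lia.
by exists (absz (x + h%:Z)); rewrite ?mem_iota; lia.
Qed.

Lemma mem_gsquare h z : (gnorm z <= h ^ 2)%N -> z \in gsquare h.
Proof.
case: z => x y; rewrite /gnorm /= => hn.
by apply/allpairsP; exists (x, y); rewrite /= !mem_irange; split=> //; nia.
Qed.

Lemma size_irange h : (0 < h -> size (irange h) <= 3 * h)%N.
Proof. by rewrite size_map size_iota; lia. Qed.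

Lemma size_gsquare h : (0 < h -> size (gsquare h) <= 9 * h ^ 2)%N.
Proof. by move/size_irange => ?; rewrite size_allpairs; nia. Qed.

Lemma size_gbox H : all (leq 1) H ->
  (size (gbox H) <= 9 ^ size H * (\prod_(h <- H) h) ^ 2)%N.
Proof.
elim: H => [|h H IH]; first by rewrite big_nil.
rewrite [all _ _]/= => /andP[/size_gsquare h0 /IH hH].
rewrite big_cons size_allpairs expnMn [size (h :: H)]/= expnS.
by rewrite mulnACA leq_mul.
Qed.

Lemma gbox_size H w : w \in gbox H -> size w = size H.
Proof.
elim: H w => [|h H IH] w; first by rewrite inE => /eqP ->.
by move=> /allpairsP[[z v] [_ /IH e ->]] /=; rewrite e.
Qed.

(** All elements lie less than [L / Q] above the least one, which leaves room for at most
    [L / Q + 1] integers. *)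
Lemma count_close (p : pred nat) (m L Q : nat) : (0 < Q)%N ->
  (forall i j, (i <= j)%N -> p i -> p j -> (j - i) * Q < L)%N ->
  (count p (iota 0 m) * Q <= L + Q)%N.
Proof.
move=> Q0 hp; rewrite -size_filter.
have : sorted ltn (seq.filter p (iota 0 m)).
  by apply: sorted_filter; [exact: ltn_trans | exact: iota_ltn_sorted].
have : all p (seq.filter p (iota 0 m)) by exact: filter_all.
case: (seq.filter _ _) => [|x s] //; rewrite [all _ _]/= => /andP[px ps] so.
have hsub : {subset x :: s <= iota x (L %/ Q).+1}.
  move=> j; rewrite inE mem_iota => /predU1P[->|js]; first by rewrite leqnn addnS ltnS leq_addr.
  have /ltnW xj : (x < j)%N.
    by move: so => /= /(order_path_min ltn_trans)/allP; apply.
  rewrite xj /= addnS ltnS -leq_subLR leq_divRL //.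
  by rewrite ltnW // hp // (allP ps).
have := uniq_leq_size (sorted_uniq ltn_trans ltnn so) hsub.
rewrite size_iota -(leq_pmul2r Q0) => h; apply: leq_trans h _.
by rewrite mulSn addnC leq_add2r leq_divM.
Qed.

(** Two solutions differ by less than [2 * h / Q]; the additional 1 in the count is absorbed by
    [Q <= h]. *)
Lemma count_affine (a c : int) (h Q : nat) : (0 < Q <= h)%N -> a != 0 ->
  (count (fun x : int => `|(a * x + c)%R| * Q < `|a| * h)%N (irange h) * Q <= 3 * h)%N.
Proof.
case/andP => Q0 Qh a0; rewrite count_map.
apply: leq_trans (_ : h.*2 + Q <= _)%N; last by lia.
apply: count_close => // i j ij /= h1 h2.
have a1 : (0 < `|a|)%N by lia.
rewrite -(ltn_pmul2l a1).
have : (`|a| * (j - i) <= `|(a * (i%:Z - h%:Z) + c)%R| + `|(a * (j%:Z - h%:Z) + c)%R|)%N.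
  have -> : (`|a| * (j - i) = `|(a * (j%:Z - i%:Z))%R|)%N by rewrite abszM; congr muln; lia.
  have -> : a * (j%:Z - i%:Z) = (a * (j%:Z - h%:Z) + c) - (a * (i%:Z - h%:Z) + c) by ring.
  by lia.
rewrite -(leq_pmul2r Q0); nia.
Qed.

(** Linearity in each variable is over Z, with basis 1 and i, and not over Z[i]: conjugation of a
    variable must be allowed. *)
Definition multilinear (k : nat) (T : seq gint -> int) : Prop :=
  forall s1 s2 x y, (size s1 + size s2).+1 = k ->
  T (s1 ++ Gint x y :: s2) =
    x * T (s1 ++ 1 :: s2) + y * T (s1 ++ Gint 0 1 :: s2).

Lemma multilinear_cons k T z : multilinear k.+1 T ->
  multilinear k (fun w => T (z :: w)).
Proof. by move=> h s1 s2 x y e; rewrite -!cat_cons h //= -e. Qed.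

(** [M] will be the product of the sides of a box, the natural size of [T] there, and [B] the factor
    by which the value falls short of it. *)
Definition small_values (T : seq gint -> int) (B M : nat) : pred (seq gint) :=
  fun w => (T w != 0) && (`|T w| * B <= M)%N.

(** If [a] is nonzero, it exceeds [M / B] in absolute value, so for each imaginary part the real
    part is confined to a short interval by [count_affine]. If [a = 0], the roles are exchanged; if
    both vanish, so does the form, and nothing is counted. *)
Lemma count_linear_form (a b : int) (h Q B M : nat) : (0 < Q <= h)%N ->
  (a != 0 -> M < `|a| * B)%N -> (b != 0 -> M < `|b| * B)%N ->
  (count (fun z : gint => ((gre z * a + gim z * b)%R != 0) &&
     (`|(gre z * a + gim z * b)%R| * (Q * B) <= h * M)%N) (gsquare h) * Q <= 9 * h ^ 2)%N.
Proof.
move=> Qh ha hb; have h0 : (0 < h)%N by lia.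
have B0 c : (M < c * B)%N -> (0 < B)%N by case: B {ha hb} => //; lia.
have key c d e : c != 0 -> (M < `|c| * B)%N -> e = c * d ->
    forall f, (`|(e + f)%R| * (Q * B) <= h * M)%N -> (`|(c * d + f)%R| * Q < `|c| * h)%N.
  move=> c0 hc -> f hf; rewrite -(ltn_pmul2r (B0 _ hc)) -mulnA.
  apply: leq_ltn_trans hf _; rewrite -mulnA [(`|c| * (h * B))%N]mulnCA ltn_pmul2l //.
have fin (F : int -> nat) : (forall x, F x * Q <= 3 * h)%N ->
    ((\sum_(x <- irange h) F x) * Q <= 9 * h ^ 2)%N.
  move=> hF; rewrite big_distrl /=; apply: (@leq_trans (\sum_(x <- irange h) (3 * h))%N).
    by apply: leq_sum => x _; exact: hF.
  by rewrite big_const_seq count_predT iter_addn_0; have := size_irange h0; nia.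
rewrite count_allpairs; have [a0|a0] := eqVneq a 0; last first.
  rewrite exchange_count; apply: fin => y.
  apply: leq_trans (count_affine (y * b) Qh a0); rewrite leq_mul2r.
  apply/orP; right; apply: sub_count => x /= /andP[_].
  by apply: key; rewrite ?ha // mulrC.
have [b0|b0] := eqVneq b 0; last first.
  apply: fin => x.
  apply: leq_trans (count_affine (x * a) Qh b0); rewrite leq_mul2r.
  apply/orP; right; apply: sub_count => y /= /andP[_]; rewrite [x * a + _]addrC.
  by apply: key; rewrite ?hb // mulrC.
rewrite big1 // => x _; apply/eqP; rewrite -leqn0 leqNgt -has_count.
by apply/hasPn => y _; rewrite /= a0 b0 !mulr0 addr0 eqxx.
Qed.

(* Either the coefficients of the first variable are themselves small, and the
   induction hypothesis applies to them, or the first variable is confined to a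
   thin strip. *)
Lemma multilinear_count (H : seq nat) (Q : nat) (T : seq gint -> int) :
  all (leq 1) H -> (0 < Q)%N -> multilinear (size H) T ->
  (count (small_values T (Q ^ (size H).+1) (\prod_(h <- H) h)) (gbox H) * Q
    <= 36 ^ size H * (\prod_(h <- H) h) ^ 2)%N.
Proof.
move=> + Q0; elim: H T => [|h H IH] T.
  (* Without variables [T] is a constant; if it is nonzero and [|T| * Q <= 1], then [Q = 1]. *)
  move=> _ _; rewrite /= big_nil /small_values expn1 addn0.
  case: eqP => //= h0; case: (leqP (_ * Q) 1) => //; nia.
rewrite [all _ _]/= => /andP[h0 hH] mT; rewrite big_cons [size _]/=.
set k := size H; set M := (\prod_(j <- H) j)%N.
(* A side [h <= Q] is too short for strips. The first variable is then fixed, and one power of [Q]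
   pays for the factor [h] in the bound on [T]. *)
have [hQ|Qh] := leqP h Q.
  rewrite count_allpairs big_distrl /=.
  apply: (@leq_trans (\sum_(z <- gsquare h) 36 ^ k * M ^ 2)%N).
    apply: leq_sum => z _; apply: leq_trans (IH _ hH (multilinear_cons z mT)).
    rewrite leq_mul2r; apply/orP; right; apply: sub_count => w /andP[n0 hw].
    rewrite /small_values n0 /= -(leq_pmul2l Q0) mulnCA -expnS.
    by apply: leq_trans hw _; rewrite leq_mul2r hQ orbT.
  rewrite big_const_seq count_predT iter_addn_0 expnMn (expnS 36).
  have := size_gsquare h0; move: (size _) (36 ^ k)%N (M ^ 2)%N => s t u hs.
  by rewrite [(_ * s)%N]mulnC [leqRHS]mulnACA leq_mul2r; nia.
pose A w := T (1 :: w); pose B w := T (Gint 0 1 :: w).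
have hA := IH A hH (multilinear_cons _ mT); have hB := IH B hH (multilinear_cons _ mT).
rewrite -/k -/M in hA hB; have hs := size_gbox hH; rewrite -/k -/M in hs.
set SA := small_values A _ _ in hA; set SB := small_values B _ _ in hB.
have Qh' : (0 < Q <= h)%N by lia.
have step w : w \in gbox H ->
  (count (fun z : gint => small_values T (Q ^ k.+2) (h * M) (z :: w)) (gsquare h) * Q <=
   9 * h ^ 2 * (SA w * Q + SB w * Q + 1))%N.
  move=> /gbox_size sw; have := size_gsquare h0 => hg.
  case SAw : (SA w); last case SBw : (SB w).
  - apply: leq_trans (leq_mul (leq_trans (count_size _ _) hg) (leqnn Q)) _.
    by rewrite leq_mul2l mul1n -addnA leq_addr orbT.
  - apply: leq_trans (leq_mul (leq_trans (count_size _ _) hg) (leqnn Q)) _.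
    by rewrite leq_mul2l mul1n leq_addr orbT.
  rewrite !mul0n !add0n muln1.
  have sm U : small_values U (Q ^ k.+1) M w = false -> U w != 0 ->
      (M < `|U w| * Q ^ k.+1)%N.
    by rewrite /small_values => + n0; rewrite n0 /= leqNgt => /negbFE.
  apply: leq_trans (count_linear_form Qh' (sm A SAw) (sm B SBw)).
  rewrite leq_mul2r; apply/orP; right; apply: sub_count => -[x y] /=.
  by rewrite /small_values (mT [::] w) //= ?sw // -expnS.
rewrite count_allpairs exchange_count big_distrl /=.
apply: (@leq_trans (\sum_(w <- gbox H) 9 * h ^ 2 * (SA w * Q + SB w * Q + 1))%N).
  by rewrite big_seq [leqRHS]big_seq; apply: leq_sum => w; exact: step.
rewrite -big_distrr /= !big_split /= -!big_distrl /=.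
have sumE (P : pred (seq gint)) : (\sum_(w <- gbox H) P w = count P (gbox H))%N.
  by rewrite -sum1_count [RHS]big_mkcond; apply: eq_bigr => w _; case: (P w).
rewrite !sumE big_const_seq count_predT iter_addn_0 mul1n.
have h9 : (9 ^ k <= 36 ^ k)%N by case: (k) => // j; rewrite leq_exp2r.
move: hs hA hB h9; rewrite expnMn (expnS 36).
move: (count SA _ * Q)%N (count SB _ * Q)%N (size _) (9 ^ k)%N (36 ^ k)%N (M ^ 2)%N (h ^ 2)%N.
move=> ca cb s t9 t36 m2 h2 hs hA hB h9.
(* The two sets of small coefficients and the strips each contribute at most [36 ^ k * M ^ 2], so
   the new constant is [9 * 3 <= 36]. *)
have : (s <= t36 * m2)%N by apply: leq_trans hs _; rewrite leq_mul2r h9 orbT.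
nia.
Qed.

(** * Covering by boxes *)

Fixpoint seqs_over (T : Type) (L : seq T) (n : nat) : seq (seq T) :=
  if n is n'.+1 then [seq x :: s | x <- L, s <- seqs_over L n'] else [:: [::]].

Lemma mem_seqs_over (T : eqType) (L : seq T) n s :
  (s \in seqs_over L n) = (size s == n) && all (fun x => x \in L) s.
Proof.
elim: n s => [|n IH] s; first by rewrite inE; case: s.
apply/allpairsP/idP => [[[x s'] /= [xL]]|].
  by rewrite IH => /andP[/eqP <- h] ->; rewrite /= eqxx xL h.
by case: s => // x s /= /andP[n_s /andP[xL h]]; exists (x, s); rewrite /= IH -eqSS n_s h.
Qed.

Lemma size_seqs_over (T : Type) (L : seq T) n : size (seqs_over L n) = (size L ^ n)%N.
Proof. by elim: n => //= n IH; rewrite size_allpairs IH expnS. Qed.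

Lemma size_flatten_map (S T : eqType) (f : S -> seq T) s q c :
  (forall x, x \in s -> size (f x) * q <= c)%N ->
  (size (flatten (map f s)) * q <= size s * c)%N.
Proof.
elim: s => [|x s IH] h //=; rewrite size_cat mulnDl mulSn leq_add ?h ?mem_head //.
by apply: IH => y ys; rewrite h // inE ys orbT.
Qed.

(** Side lengths on a geometric grid: the number of boxes depends on [D] and [k] only, while [P]
    will be roughly a [D]-th root of the range of [n]. *)
Definition scales (P D k : nat) := seqs_over [seq (P ^ j)%N | j <- iota 0 D.+1] k.

Lemma scale_cover1 P D n : (1 < P)%N -> (0 < n <= P ^ D)%N ->
  exists j, [/\ (j <= D)%N, (n <= (P ^ j) ^ 2)%N & ((P ^ j) ^ 2 <= P ^ 2 * n)%N].
Proof.
move=> P1 /andP[n0 nD].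
have PD : (n <= (P ^ D) ^ 2)%N by rewrite (leq_trans nD) // leq_pmulr ?expn_gt0 //; lia.
(* By minimality of [j] the preceding scale is too small, which bounds the overshoot by [P ^ 2]. *)
case: (ex_minnP (ex_intro (fun j => n <= (P ^ j) ^ 2)%N D PD)) => j nj hj.
exists j; split=> //; first exact: hj.
case: j nj hj => [|j] nj hj.
  by rewrite expn0 exp1n muln_gt0 n0 expn_gt0 andbT; lia.
have : ~~ (n <= (P ^ j) ^ 2)%N by apply/negP => /hj; rewrite ltnn.
by rewrite -ltnNge (expnS P j) expnMn leq_mul2l => /ltnW ->; rewrite orbT.
Qed.

Lemma scale_cover P D (w : seq gint) : (1 < P)%N ->
  {in w, forall z, (0 < gnorm z <= P ^ D)%N} ->
  exists2 H, H \in scales P D (size w) &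
    [/\ w \in gbox H, (\prod_(z <- w) gnorm z <= (\prod_(h <- H) h) ^ 2)%N &
      ((\prod_(h <- H) h) ^ 2 <= P ^ (2 * size w) * \prod_(z <- w) gnorm z)%N].
Proof.
move=> P1; elim: w => [|z w IH] hw.
  by exists [::]; rewrite ?mem_seqs_over ?big_nil //.
have [|H + [h1 h2 h3]] := IH; first by move=> v vw; apply: hw; rewrite inE vw orbT.
rewrite mem_seqs_over => /andP[/eqP sH aH].
have [j [jD n1 n2]] := scale_cover1 P1 (hw z (mem_head _ _)).
exists (P ^ j :: H)%N.
  rewrite mem_seqs_over [size (_ :: H)]/= sH eqxx; apply/allP => h.
  by rewrite inE => /predU1P[->|/(allP aH)//]; apply/map_f; rewrite mem_iota.
rewrite !big_cons expnMn; split; last 1 first.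
- by rewrite mulnS expnD mulnACA leq_mul.
- by apply/allpairsP; exists (z, w); rewrite /= mem_gsquare.
- exact: leq_mul.
Qed.

Lemma scales_pos P D k H : (0 < P)%N -> H \in scales P D k ->
  size H = k /\ all (leq 1) H.
Proof.
move=> P0; rewrite mem_seqs_over => /andP[/eqP sH /allP aH]; split=> //.
by apply/allP => h /aH /mapP[j _ ->]; rewrite expn_gt0 P0.
Qed.

Lemma size_scales P D k : size (scales P D k) = (D.+1 ^ k)%N.
Proof. by rewrite size_seqs_over size_map size_iota. Qed.

Lemma prod_pos_mem_le (w : seq gint) z :
  (0 < \prod_(x <- w) gnorm x)%N -> z \in w ->
  (0 < gnorm z <= \prod_(x <- w) gnorm x)%N.
Proof.
elim: w => // x w IH; rewrite big_cons muln_gt0 inE => /andP[x0 w0] /predU1P[->|/(IH w0)].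
  by rewrite x0 leq_pmulr.
by case/andP => -> /leq_trans; apply; rewrite leq_pmull.
Qed.

Lemma leqS_pow2 Q e : (0 < Q -> Q.+1 ^ e <= 2 ^ e * Q ^ e)%N.
Proof.
by move=> Q0; rewrite -expnMn; case: e => // e; rewrite leq_exp2r //; lia.
Qed.

(** Each exceptional [n] is the norm product of a small-value point in one of the boxes. Of the
    saving [Q ^ (2 * k + e)] from [multilinear_count], the part [Q ^ (2 * k)] pays for the overshoot
    of the boxes. *)
Lemma exceptional_count (I : eqType) (T : I -> seq gint -> int) (L : seq I)
    (k e D Q N : nat) (E : seq nat) :
  (0 < Q)%N -> (N <= Q.+1 ^ D)%N ->
  (forall i, i \in L -> multilinear k (T i)) -> uniq E ->
  (forall n, n \in E -> (0 < n <= N)%N /\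
    exists i w, [/\ i \in L, size w = k, \prod_(z <- w) gnorm z = n, T i w != 0 &
      (`|T i w| ^ 2 * ((Q ^ (2 * k + e)) ^ k.+1) ^ 2 <= n)%N]) ->
  (size E * Q ^ e <= size L * D.+1 ^ k * 144 ^ k * N)%N.
Proof.
move=> Q0 ND mT uE hE; set B := ((Q ^ _) ^ _)%N in hE.
pose Hs := [seq H <- scales Q.+1 D k |
  ((\prod_(h <- H) h) ^ 2 <= Q.+1 ^ (2 * k) * N)%N].
pose F := flatten [seq flatten [seq
  [seq (\prod_(z <- w) gnorm z)%N | w <- gbox H & small_values (T i) B (\prod_(h <- H) h) w]
  | H <- Hs] | i <- L].
have EF : {subset E <= F}.
  move=> n /hE [/andP[n0 nN] [i [w [iL sw hw Tw hT]]]].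
  have [z zw|H H1 [H2 H3 H4]] := @scale_cover Q.+1 D w Q0.
    have := @prod_pos_mem_le w z; rewrite hw => /(_ n0 zw) /andP[-> hz].
    by rewrite (leq_trans hz) // (leq_trans nN).
  rewrite sw in H1 H4; rewrite hw in H3 H4.
  apply/flatten_mapP; exists i => //; apply/flatten_mapP; exists H.
    by rewrite mem_filter H1 (leq_trans H4) // leq_mul2l nN orbT.
  apply/mapP; exists w => //; rewrite mem_filter H2 andbT /small_values Tw /=.
  by rewrite -leq_sqr expnMn (leq_trans hT).
apply: leq_trans (leq_mul (uniq_leq_size uE EF) (leqnn _)) _.
rewrite -!mulnA; apply: size_flatten_map => i iL.
apply: (@leq_trans (size Hs * (144 ^ k * N))); last first.
  by rewrite leq_mul2r -(size_scales Q.+1 D k) size_filter count_size orbT.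
apply: size_flatten_map => H; rewrite mem_filter => /andP[hH /scales_pos [//|sH aH]].
rewrite size_map size_filter.
have Qg : (0 < Q ^ (2 * k + e))%N by rewrite expn_gt0 Q0.
have := @multilinear_count H _ (T i) aH Qg; rewrite sH => /(_ (mT i iL)).
rewrite -/B => hc; have Qk : (0 < Q ^ (2 * k))%N by rewrite expn_gt0 Q0.
rewrite -(leq_pmul2r Qk) -mulnA -expnD [(e + _)%N]addnC; apply: leq_trans hc _.
apply: leq_trans (leq_mul (leqnn _) hH) _.
have := leqS_pow2 (2 * k) Q0; rewrite (expnM 2 2 k) => h2.
(* The factor [4 ^ k] comes from replacing [Q.+1 ^ (2 * k)] by [Q ^ (2 * k)]. *)
have -> : (144 ^ k = 36 ^ k * 4 ^ k)%N by rewrite -expnMn.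
rewrite -!mulnA leq_mul2l; apply/orP; right.
by rewrite [(N * _)%N]mulnC mulnA leq_mul2r h2 orbT.
Qed.

(** * Lower bound for the number of sums of two squares *)

(** Cauchy-Schwarz for the fibre sizes [r v]: their sum is [size A], and the sum of their squares
    counts the collisions. *)
Lemma card_image_collisions (S T : eqType) (f : S -> T) (A : seq S) :
  (size A ^ 2 <= size (undup (map f A)) *
    size [seq p <- [seq (a, b) | a <- A, b <- A] | f p.1 == f p.2])%N.
Proof.
set V := undup _; set E := size (seq.filter _ _).
pose r v := count (fun a => f a == v) A.
have sumr (g : T -> nat) : (\sum_(v <- V) r v * g v = \sum_(a <- A) g (f a))%N.
  under eq_bigr => v _ do rewrite /r -sum1_count big_distrl /= big_mkcond.
  rewrite exchange_big /= big_seq [RHS]big_seq; apply: eq_bigr => a aA.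
  rewrite (bigD1_seq (f a)) ?undup_uniq ?mem_undup ?map_f //= eqxx mul1n.
  by rewrite big1 ?addn0 // => v; rewrite eq_sym => /negPf ->.
have s1 : (\sum_(v <- V) r v = size A)%N.
  by under eq_bigr do rewrite -[r _]muln1; rewrite sumr sum1_size.
have s2 : (\sum_(v <- V) r v ^ 2 = E)%N.
  rewrite (eq_bigr (fun v => r v * r v)%N) // sumr /E size_filter count_allpairs.
  by apply: eq_bigr => a _; apply: eq_count => b /=; rewrite eq_sym.
have [V0|V0] := posnP (size V).
  by move: s1; rewrite (size0nil V0) big_nil => <-.
rewrite -(leq_pmul2l V0).
(* The inequality [2xy <= x^2 + y^2] with [x = size V * r v] and [y = size A], summed over the
   image. *)
have : (\sum_(v <- V) 2 * ((size V * r v) * size A) <=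
    \sum_(v <- V) ((size V * r v) ^ 2 + size A ^ 2))%N.
  by apply: leq_sum => v _; exact: nat_Cauchy.
rewrite -big_distrr /= -big_distrl /= -big_distrr /= s1 big_split /=.
under [X in (_ <= X + _)%N -> _]eq_bigr do rewrite expnMn.
rewrite -big_distrr /= s2 big_const_seq count_predT iter_addn_0; nia.
Qed.

(** By [same_norm] such a pair is [(g * b, u * (g * gconj b))], so it is determined by [u] and a
    point [(g, b)] of a box. The 9 bounds the choices of [u], and [36 ^ 2] is [9 ^ 2] from the box
    times [2 ^ 4] from [Q.+1 <= 2 * Q]. *)
Lemma same_norm_pairs (D Q N : nat) (G : seq gint) :
  (0 < Q)%N -> (N <= Q.+1 ^ D)%N -> uniq G ->
  {in G, forall z, (0 < gnorm z <= N)%N} ->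
  (size [seq p <- [seq (a, b) | a <- G, b <- G] | gnorm p.1 == gnorm p.2]
    <= 9 * (D.+1 ^ 2 * (36 ^ 2 * (Q ^ 4 * N))))%N.
Proof.
move=> Q0 ND uG hG.
pose Hs := [seq H <- scales Q.+1 D 2 |
  ((\prod_(h <- H) h) ^ 2 <= Q.+1 ^ (2 * 2) * N)%N].
pose par (u : gint) (w : seq gint) : gint * gint :=
  (w`_0 * w`_1, u * (w`_0 * gconj w`_1)).
pose F := flatten [seq flatten [seq [seq par u w | w <- gbox H] | H <- Hs] | u <- gsquare 1].
set Z := seq.filter _ _.
have uZ : uniq Z.
  by apply: filter_uniq; apply: allpairs_uniq => // -[a b] [c d] /= _ _ [-> ->].
have ZF : {subset Z <= F}.
  move=> [z z']; rewrite mem_filter /= => /andP[/eqP e /allpairsP[[a b] /= [aG bG [ez ez']]]].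
  subst a b; have /andP[z0 zN] := hG z aG; rewrite gnorm_gt0 in z0.
  have [g [b [u [nu hz hz']]]] := same_norm z0 e.
  have hp : (\prod_(x <- [:: g; b]) gnorm x)%N = gnorm z.
    by rewrite !big_cons big_nil muln1 hz gnormM.
  have [x xw|H H1 [H2 H3 H4]] := @scale_cover Q.+1 D [:: g; b] Q0.
    have := @prod_pos_mem_le [:: g; b] x; rewrite hp gnorm_gt0 => /(_ z0 xw) /andP[-> hx].
    by rewrite (leq_trans hx) // (leq_trans zN).
  rewrite hp in H4.
  apply/flatten_mapP; exists u; first by apply: mem_gsquare; rewrite nu.
  apply/flatten_mapP; exists H.
    by rewrite mem_filter H1 (leq_trans H4) // leq_mul2l zN orbT.
  by apply/mapP; exists [:: g; b] => //; rewrite /par /= -hz -hz'.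
apply: leq_trans (uniq_leq_size uZ ZF) _; rewrite -[size F]muln1.
apply: (@leq_trans (size (gsquare 1) * (D.+1 ^ 2 * (36 ^ 2 * (Q ^ 4 * N))))); last first.
  by rewrite leq_mul2r size_gsquare ?orbT.
apply: size_flatten_map => u _.
apply: (@leq_trans (size Hs * (36 ^ 2 * (Q ^ 4 * N)))); last first.
  by rewrite leq_mul2r -(size_scales Q.+1 D 2) size_filter count_size orbT.
apply: size_flatten_map => H; rewrite mem_filter => /andP[hH /scales_pos [//|sH aH]].
rewrite size_map muln1; apply: leq_trans (size_gbox aH) _; rewrite sH.
apply: leq_trans (leq_mul (leqnn _) hH) _.
have := leqS_pow2 4 Q0; move: (Q.+1 ^ _)%N (Q ^ _)%N => a b hab.
by rewrite mulnA [leqRHS]mulnA leq_mul2r; apply/orP; right; lia.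
Qed.

(** The norm on the grid [G] of side [s], about [sqrt (N / 2)], has few collisions by
    [same_norm_pairs], hence a large image. *)
Lemma sums_of_squares_lower (D Q N : nat) (V : seq nat) :
  (0 < Q)%N -> (2 <= N <= Q.+1 ^ D)%N ->
  (forall x y : nat, (0 < x)%N -> (0 < y)%N -> (x ^ 2 + y ^ 2 <= N)%N ->
    (x ^ 2 + y ^ 2)%N \in V) ->
  (N <= 864 ^ 2 * (D.+1 ^ 2 * (Q ^ 4 * size V)))%N.
Proof.
move=> Q0 /andP[N2 ND] hV.
have [s [s1 s2]] : exists s, (2 * s ^ 2 <= N)%N /\ (N < 2 * s.+1 ^ 2)%N.
  have h0 : exists s, (2 * s ^ 2 <= N)%N by exists 0%N.
  have hb s : (2 * s ^ 2 <= N)%N -> (s <= N)%N by nia.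
  case: (ex_maxnP h0 hb) => s hs hmax; exists s; split=> //.
  by rewrite ltnNge; apply/negP => /hmax; rewrite ltnn.
have s0 : (0 < s)%N by case: s s1 s2 => //; lia.
pose G := [seq Gint x%:Z y%:Z | x <- iota 1 s, y <- iota 1 s].
have uG : uniq G.
  by apply: allpairs_uniq; rewrite ?iota_uniq // => -[a b] [c d] /= _ _ [-> ->].
have hG z : z \in G -> (0 < gnorm z <= N)%N /\ gnorm z \in V.
  case/allpairsP => -[x y] /= [+ + ->]; rewrite !mem_iota /gnorm /= => hx hy.
  have h : (x ^ 2 + y ^ 2 <= N)%N by apply: leq_trans s1; nia.
  by case/andP: hx hy => x0 _ /andP[y0 _]; rewrite h hV // addn_gt0 expn_gt0 x0.
have hp := @same_norm_pairs D Q N G Q0 ND uG (fun z zG => (hG z zG).1).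
have hc := card_image_collisions gnorm G.
have hs : (size (undup (map gnorm G)) <= size V)%N.
  apply: uniq_leq_size (undup_uniq _) _ => v; rewrite mem_undup => /mapP[z zG ->].
  by case: (hG z zG).
have sG : size G = (s ^ 2)%N by rewrite size_allpairs !size_iota.
have {hc} := leq_trans hc (leq_mul hs hp); rewrite sG.
move: (D.+1 ^ 2)%N (Q ^ 4)%N (size V) => d q v h.
have N8 : (N <= 8 * s ^ 2)%N by nia.
have : (N ^ 2 <= 64 * (s ^ 2) ^ 2)%N by have := leq_mul N8 N8; nia.
(* From [N <= 8 * s ^ 2] comes [N ^ 2 <= 64 * s ^ 4]; one factor [N] cancels, and
   [64 * 9 * 36 ^ 2 = 864 ^ 2]. *)
move/leq_trans => /(_ _ (leq_mul (leqnn 64) h)) h2.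
have N0 : (0 < N)%N by lia.
rewrite -(leq_pmul2r N0); nia.
Qed.

(** * Exceptional integers *)

Definition gcoord (t : bool) (z : gint) : int := if t then gim z else gre z.

Lemma gcoordD t : {morph gcoord t : z w / z + w}.
Proof. by case: t. Qed.

Lemma gcoordZ t x z : gcoord t (Gint x 0 * z) = x * gcoord t z.
Proof. by case: t; rewrite gmulE /=; ring. Qed.

Lemma gtwist_linear b x y :
  gtwist b (Gint x y) = Gint x 0 * gtwist b 1 + Gint y 0 * gtwist b (Gint 0 1).
Proof. by case: b; apply: gintP => /=; ring. Qed.

Lemma gtprod_linear s s1 s2 x y : size s = (size s1 + size s2).+1 ->
  gtprod s (s1 ++ Gint x y :: s2) = Gint x 0 * gtprod s (s1 ++ 1 :: s2) +
    Gint y 0 * gtprod s (s1 ++ Gint 0 1 :: s2).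
Proof.
elim: s1 s => [|z s1 IH] [|b s] // [e].
  by rewrite !cat0s [LHS]/= gtwist_linear /=; ring.
by rewrite !cat_cons [LHS]/= IH //=; ring.
Qed.

(** The maps [T] of the overview: an index holds the coordinate and, for each point, its unit and
    conjugation pattern. *)
Definition twisted_sum (i : bool * seq (gint * seq bool)) (w : seq gint) : int :=
  gcoord i.1 (\sum_(p <- i.2) p.1 * gtprod p.2 w).

(** [gsquare 1] is a finite set containing the four units. *)
Definition twists (k : nat) : seq (gint * seq bool) :=
  [seq (u, s) | u <- gsquare 1, s <- seqs_over [:: false; true] k].

Definition patterns (l k : nat) : seq (bool * seq (gint * seq bool)) :=
  [seq (t, p) | t <- [:: false; true], p <- seqs_over (twists k) l].

Lemma mem_bool_seqs k s : (s \in seqs_over [:: false; true] k) = (size s == k).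
Proof.
by rewrite mem_seqs_over; case: eqP => //= _; apply/allP => -[].
Qed.

Lemma multilinear_twisted_sum l k i :
  i \in patterns l k -> multilinear k (twisted_sum i).
Proof.
rewrite /patterns => /allpairsP[[t p] /= [_ + ->]]; rewrite mem_seqs_over => /andP[_ /allP hp].
move=> s1 s2 x y e; rewrite /twisted_sum /= -!gcoordZ -gcoordD; congr gcoord.
rewrite !big_distrr -big_split /= big_seq [RHS]big_seq; apply: eq_bigr => q /hp.
move=> /allpairsP[[u s] /= [_ + ->]]; rewrite mem_bool_seqs => /eqP ss /=.
by rewrite gtprod_linear ?ss //; ring.
Qed.

Lemma circle_sum_pattern (l n : nat) (t : bool) (z : nat -> gint) :
  (0 < l)%N -> (0 < n)%N -> (forall j, (j < l)%N -> gnorm (z j) = n) ->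
  exists i w, [/\ i \in patterns l (2 ^ l.-1), size w = (2 ^ l.-1)%N,
    (\prod_(x <- w) gnorm x)%N = n &
    twisted_sum i w = gcoord t (\sum_(j < l) z j)].
Proof.
case: l => // l _ n0 hz; have [w [s [u [sw pw hw]]]] := circle_param n0 hz.
have hp : [seq (u j, s j) | j <- iota 0 l.+1] \in seqs_over (twists (2 ^ l)) l.+1.
  rewrite mem_seqs_over size_map size_iota eqxx; apply/allP => _ /mapP[j jl ->].
  have [|ss nu _] := hw j; first by move: jl; rewrite mem_iota.
  by apply/allpairsP; exists (u j, s j); rewrite mem_bool_seqs ss mem_gsquare // nu.
exists (t, [seq (u j, s j) | j <- iota 0 l.+1]), w; split=> //.
- rewrite /patterns; apply/allpairsP.
  by exists (t, [seq (u j, s j) | j <- iota 0 l.+1]); split=> //; case: (t).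
- have [ss nu h] := hw 0%N isT.
  by rewrite -(hz 0%N isT) h gnormM nu mul1n gnorm_gtprod // ss sw.
rewrite /twisted_sum /fst /snd big_map -(big_mkord xpredT z) /index_iota subn0; congr gcoord.
rewrite big_seq [RHS]big_seq; apply: eq_bigr => j; rewrite mem_iota => /andP[_ /hw].
by case=> _ _ ->.
Qed.

(* The first alternative discards the n <= N / Q^5, for which n^eps need not
   dominate a power of Q. *)
Lemma exceptional_sparse (l D : nat) : (0 < l)%N ->
  exists C : nat, forall (Q N : nat) (E V : seq nat),
  (0 < Q)%N -> (2 <= N <= Q.+1 ^ D)%N -> uniq E ->
  (forall x y : nat, (0 < x)%N -> (0 < y)%N -> (x ^ 2 + y ^ 2 <= N)%N ->
    (x ^ 2 + y ^ 2)%N \in V) ->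
  (forall n, n \in E -> (0 < n <= N)%N /\ ((n * Q ^ 5 <= N)%N \/
    exists t (z : nat -> gint),
      [/\ forall j, (j < l)%N -> gnorm (z j) = n,
        gcoord t (\sum_(j < l) z j) != 0 &
        (`|gcoord t (\sum_(j < l) z j)%R| ^ 2 *
          (Q ^ ((2 * 2 ^ l.-1 + 5) * (2 ^ l.-1).+1)) ^ 2 <= n)%N])) ->
  (size E * Q <= C * size V)%N.
Proof.
move=> l0; pose k := (2 ^ l.-1)%N.
pose C1 := (size (patterns l k) * D.+1 ^ k * 144 ^ k)%N.
exists (C1.+1 * (864 ^ 2 * D.+1 ^ 2))%N => Q N E V Q0 N2D uE hV hE.
have N2 : (N <= Q.+1 ^ D)%N by case/andP: N2D.
have hN := sums_of_squares_lower Q0 N2D hV.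
pose E1 := [seq n <- E | (n * Q ^ 5 <= N)%N].
pose E2 := [seq n <- E | ~~ (n * Q ^ 5 <= N)%N].
have sE : size E = (size E1 + size E2)%N by rewrite !size_filter count_predC.
have Q5 : (0 < Q ^ 5)%N by rewrite expn_gt0 Q0.
have Q4 : (0 < Q ^ 4)%N by rewrite expn_gt0 Q0.
have h1 : (size E1 * Q ^ 5 <= N)%N.
  rewrite -leq_divRL // -(size_iota 1 (N %/ Q ^ 5)); apply: uniq_leq_size.
    exact: filter_uniq.
  move=> n; rewrite mem_filter mem_iota add1n ltnS leq_divRL // => /andP[-> /hE].
  by case=> /andP[-> _].
have h2 : (size E2 * Q ^ 5 <= C1 * N)%N.
  apply: (@exceptional_count _ twisted_sum) => //.
  - by move=> i; exact: multilinear_twisted_sum.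
  - exact: filter_uniq.
  - move=> n; rewrite mem_filter => /andP[/negbTE nQ /hE [n0N]]; rewrite nQ.
    case=> // -[t [z [hz T0 hT]]]; split=> //.
    have n0 : (0 < n)%N by case/andP: n0N.
    have [i [w [il sw pw Tw]]] := circle_sum_pattern t l0 n0 hz.
    by exists i, w; rewrite Tw -(expnM Q (2 * k + 5)); split.
have h3 : (size E * Q ^ 5 <= C1.+1 * N)%N by rewrite sE mulnDl mulSn leq_add.
(* The saving [Q ^ 5] on the exceptional side beats the loss [Q ^ 4] in the lower bound for [size V]
   by one factor [Q]. *)
rewrite -(leq_pmul2r Q4) -[X in (X <= _)%N]mulnA -expnS.
apply: leq_trans h3 _; rewrite -!(mulnA C1.+1) leq_mul2l; apply/orP; right.
by apply: leq_trans hN _; rewrite -[X in (_ <= X)%N]mulnA [(size V * _)%N]mulnC mulnA.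
Qed.

(** * Real cutoffs, real exponents and density *)

Definition members (A : set nat) (N : nat) : seq nat :=
  [seq n <- iota 1 N | `[< A n >]].

Lemma count_leE (R : realType) (A : set nat) (X : R) : 0 <= X ->
  A `<=` [set n | (0 < n)%N] -> count_le A X = size (members A (Num.truncn X)).
Proof.
move=> X0 A0; rewrite /count_le.
have -> : [set n | A n /\ n%:R <= X] = [set` [fset n in members A (Num.truncn X)]%fset].
  apply/seteqP; split => n /=; rewrite in_fset mem_filter mem_iota add1n ltnS.
    by case=> An nX; rewrite asboolT // (A0 _ An) truncn_ge_nat.
  by case/andP => /asboolP An /andP[_]; rewrite truncn_ge_nat.
by rewrite set_fsetK card_fseq undup_id // filter_uniq // iota_uniq.
Qed.

Definition gint_of (v : 'rV[int]_2) : gint := Gint (v 0 0) (v 0 1).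

Lemma sum_coordE (l : nat) (xi : l.-tuple 'rV[int]_2) (t : 'I_2) :
  \sum_(j < l) tnth xi j 0 t =
  gcoord (t == 1) (\sum_(j < l) gint_of (nth 0 xi j)).
Proof.
have hsum b (F : 'I_l -> gint) : gcoord b (\sum_(j < l) F j) = \sum_(j < l) gcoord b (F j).
  by apply: (big_morph _ (gcoordD b)); case: b.
rewrite hsum; apply: eq_bigr => j _; rewrite (tnth_nth 0).
by case: t => -[|[|//]] i /=; congr (_ _ _); apply/val_inj.
Qed.

Lemma gnorm_gint_of (n : nat) (v : 'rV[int]_2) : sqnorm v = n%:Z -> gnorm (gint_of v) = n.
Proof. by move=> h; apply/eqP; rewrite -eqz_nat gnormE -h. Qed.

(** Since [n >= Q ^ c] and [c * eps >= b], the factor [n^eps] is at least [Q ^ b]; so [|s| * Q ^ b]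
    is at most the square root of [n], and squaring returns to natural numbers. *)
Lemma powR_small (R : realType) (eps : R) (b c n Q : nat) (s : int) :
  0 < eps -> b%:R <= c%:R * eps -> (0 < Q)%N -> (Q ^ c <= n)%N ->
  `|s|%:~R <= n%:R `^ (2^-1 - eps) -> (`|s| ^ 2 * (Q ^ b) ^ 2 <= n)%N.
Proof.
move=> e0 bc Q0 cn hs.
have n0 : (0 < n)%N by rewrite (leq_trans _ cn) // expn_gt0 Q0.
have n1 : 0 < n%:R :> R by rewrite ltr0n.
have hQ : (Q ^ b)%:R <= n%:R `^ eps :> R.
  apply: (@le_trans _ _ ((Q ^ c)%:R `^ eps)); last first.
    by apply: ge0_ler_powR; rewrite ?nnegrE ?ler0n ?ler_nat // ltW.
  rewrite !natrX -!powR_mulrn // -powRrM; apply: ler_powR => //.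
  by rewrite ler1n.
have h : `|s|%:~R * (Q ^ b)%:R <= n%:R `^ 2^-1 :> R.
  apply: (@le_trans _ _ (n%:R `^ (2^-1 - eps) * n%:R `^ eps)).
    by apply: ler_pM; rewrite ?ler0n // ler0z.
  by rewrite -powRD ?subrK // gt_eqF // implybT.
rewrite -expnMn -(ler_nat R) natrX natrM.
have -> : n%:R = (n%:R `^ 2^-1) ^+ 2 :> R.
  by rewrite powR12_sqrt ?ler0n // sqr_sqrtr ?ler0n.
have -> : `|s|%N%:R = `|s|%:~R :> R by rewrite -abszE.
by rewrite ler_pXn2r // nnegrE ?mulr_ge0 ?powR_ge0 ?ler0z.
Qed.

Lemma root_bracket (D N : nat) : (0 < D)%N -> (0 < N)%N ->
  exists Q, (Q ^ D <= N < Q.+1 ^ D)%N.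
Proof.
move=> D0 N0.
have h0 : exists Q, (Q ^ D <= N)%N by exists 0%N; rewrite exp0n.
have hb Q : (Q ^ D <= N)%N -> (Q <= N)%N.
  by case: D D0 {h0} => // D _; case: Q => // Q; apply: leq_trans;
  rewrite expnS leq_pmulr ?expn_gt0.
case: (ex_maxnP h0 hb) => Q hQ hmax; exists Q; rewrite hQ ltnNge.
by apply/negP => /hmax; rewrite ltnn.
Qed.

Theorem theorem1p4 (R : realType) (eps : R) (l : nat) (eps_gt0 : 0 < eps)
    (l_gt0 : (0 < l)%N) :
  exists S0 : set nat, density_one R S0 /\
    forall n : nat, S0 n -> forall t : 'I_2,
      Vset t n l (n%:R `^ (2^-1 - eps)) = set0.
Proof.
pose good (n : nat) := forall t : 'I_2, Vset t n l (n%:R `^ (2^-1 - eps)) = set0.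
(* [b] is the exponent required by [exceptional_sparse], and [c] makes [c * eps >= b]. With
   [D = c + 5], the bounds [Q ^ D <= N] and [N < n * Q ^ 5] yield [Q ^ c <= n], as [powR_small]
   demands. *)
pose b := ((2 * 2 ^ l.-1 + 5) * (2 ^ l.-1).+1)%N.
pose c := (Num.truncn (b%:R / eps)).+1.
pose D := (c + 5)%N.
have bc : b%:R <= c%:R * eps.
  rewrite -ler_pdivrMr //; have /truncn_itv/andP[_ /ltW //] : 0 <= b%:R / eps.
  by rewrite divr_ge0 // ltW.
have [C hC] := exceptional_sparse D l_gt0.
exists (two_squares `&` good); split; last by move=> n [].
split; first by move=> n [].
have Spos : two_squares `<=` [set n | (0 < n)%N] by move=> n [].
(* The exceptional proportion is at most [C / q] once [X >= (2 * q) ^ D]. With [Q] the integer part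
   of the [D]-th root of [N], this threshold gives [2 * q < Q.+1], hence [q <= Q]. *)
have count_bound (q : nat) (X : R) : (0 < q)%N -> ((2 * q) ^ D)%:R <= X ->
    (count_le (two_squares `&` good) X <= count_le two_squares X)%N /\
    ((count_le two_squares X - count_le (two_squares `&` good) X) * q
       <= C * count_le two_squares X)%N /\ (0 < count_le two_squares X)%N.
  move=> q0 qX; have X0 : 0 <= X by apply: le_trans qX; rewrite ler0n.
  rewrite !count_leE //; last by move=> n [/Spos].
  set N := Num.truncn X; have qN : ((2 * q) ^ D <= N)%N by rewrite truncn_ge_nat.
  have N2 : (2 <= N)%N.
    apply: leq_trans qN; rewrite /D addnS expnS; apply: leq_trans (leq_pmulr 2 q0) _.
    by rewrite leq_pmulr // expn_gt0 muln_gt0 q0.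
  have D0 : (0 < D)%N by rewrite /D addnS.
  have [Q /andP[QN NQ]] := root_bracket D0 (ltnW N2).
  have qQ : (q <= Q)%N.
    have : (2 * q < Q.+1)%N by rewrite -(ltn_exp2r _ _ D0) (leq_ltn_trans qN).
    by lia.
  have Q0 := leq_trans q0 qQ.
  pose E := [seq n <- members two_squares N | ~~ `[< good n >]].
  have sizes : size (members two_squares N) =
      (size (members (two_squares `&` good) N) + size E)%N.
    have -> : members (two_squares `&` good) N =
        [seq n <- members two_squares N | `[< good n >]].
      rewrite /members -filter_predI; apply: eq_filter => n /=.
      by rewrite asbool_and andbC.
    by rewrite -(count_predC (fun n => `[< good n >]) (members _ N)) -!size_filter.
  have memV x y : (0 < x)%N -> (0 < y)%N -> (x ^ 2 + y ^ 2 <= N)%N ->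
      (x ^ 2 + y ^ 2)%N \in members two_squares N.
    move=> x0 y0 xyN; have p0 : (0 < x ^ 2 + y ^ 2)%N by rewrite addn_gt0 expn_gt0 x0.
    rewrite mem_filter mem_iota p0 add1n ltnS xyN !andbT; apply/asboolP; split=> //.
    by exists x%:Z, y%:Z; rewrite PoszD !PoszM; lia.
  have V0 : (0 < size (members two_squares N))%N.
    by have := memV 1%N 1%N isT isT N2; case: (members _ _).
  rewrite sizes leq_addr addKn -sizes; split=> //; split=> //.
  apply: leq_trans (_ : size E * Q <= _)%N; first by rewrite leq_mul2l qQ orbT.
  apply: (hC Q N) => //; first by rewrite N2 ltnW.
    by rewrite !filter_uniq // iota_uniq.
  move=> n; rewrite !mem_filter mem_iota add1n ltnS => /and3P[/asboolPn ngood _ nN].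
  split=> //; case: (leqP (n * Q ^ 5) N) => nQ; first by left.
  right; have [t /eqP/set0P[xi [hn [s0 hs]]]] := (existsNP _).2 ngood.
  exists (t == 1), (fun j => gint_of (nth 0 xi j)); rewrite -sum_coordE.
  have Qc : (Q ^ c <= n)%N.
    have Q5 : (0 < Q ^ 5)%N by rewrite expn_gt0 Q0.
    by rewrite -(leq_pmul2r Q5) -expnD (leq_trans QN) // ltnW.
  split; last exact: powR_small eps_gt0 bc Q0 Qc hs.
    by move=> j jl; apply: gnorm_gint_of; have := hn (Ordinal jl); rewrite (tnth_nth 0).
  by rewrite -normr_gt0.
apply/cvgrPdist_le => e e0.
(* Chosen so that [C / q <= e]. *)
pose q := (Num.truncn (C%:R / e)).+1.
have Cq : C%:R <= q%:R * e.
  rewrite -ler_pdivrMr //; have /truncn_itv/andP[_ /ltW //] : 0 <= C%:R / e.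
  by rewrite divr_ge0 // ltW.
near=> X.
have qX : ((2 * q) ^ D)%:R <= X by near: X; exact: nbhs_pinfty_ge.
have [h1 [h2 h3]] := count_bound q X isT qX.
set s := count_le two_squares X in h1 h2 h3 *; set a := count_le _ X in h1 h2 *.
have s0 : 0 < s%:R :> R by rewrite ltr0n.
have -> : 1 - a%:R / s%:R = (s - a)%:R / s%:R :> R.
  by rewrite natrB // mulrBl divff // gt_eqF.
rewrite ger0_norm ?divr_ge0 ?ler0n // ler_pdivrMr // -(@ler_pM2r _ q%:R) ?ltr0n //.
rewrite -natrM; apply: (@le_trans _ _ (C * s)%:R); first by rewrite ler_nat.
by rewrite natrM mulrAC ler_pM2r // mulrC.
Unshelve. all: by end_near.
Qed.
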